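(* Let $d\ge 1$ and $A\in H_{2d}^+(\mathbb{C})$ satisfy Assumptions I and II, and let $W_{<1}\in M_d(\mathbb{C})$ be a diagonalizable matrix. The following assertions are equivalent: (i) The matrix $B_R=A_{LL}+A_{LR}W_{<1}$ is right Schur-invariant for $A$. (ii) The matrix $W_{<1}$ is diagonal in the basis $(u_w)_{w\in\mathcal{S}_{<1}}$ of $\mathbb{C}^d$, with $W_{<1}u_w=wu_w$ for all $w\in\mathcal{S}_{<1}$. (iii) For every $\boldsymbol{x}\in\mathbb{C}^d$, the sequence $(x_k)_{k\ge0}$ defined by $x_0=\boldsymbol{x}$ and $x_k=W_{<1}^kx_0$ for $k\ge1$ is a solution of the discrete Dirichlet-type problem $$A_{RL}x_{k-1}+(A_{LL}+A_{RR})x_k+A_{LR}x_{k+1}=0\ \text{ for all } k>0,\qquad x_0=\boldsymbol{x},\qquad \lim_{k\to+\infty}x_k=0.$$ Moreover, when these assertions hold, for all $\alpha,\beta_R>0$ the function $\boldsymbol{e}'_{\beta_R,B_R}$ satisfies $\int_{\mathbb{C}^d}\boldsymbol{e}_{\alpha,A}(x,y)\,\boldsymbol{e}'_{\beta_R,B_R}(y)\,dy=\Lambda\,\boldsymbol{e}'_{\beta_R,B_R}(x)$ for all $x\in\mathbb{C}^d$, with eigenvalue $$\Lambda=\alpha(2\pi)^d(-1)^d\,\frac{\prod_{w\in\mathcal{S}_{<1}}w}{\det(A_{RL})}.$$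
   Context: $H_n^+(\mathbb{C})$ is the set of $n\times n$ complex Hermitian positive definite matrices. A matrix $A\in H_{2d}^+(\mathbb{C})$ is written in $d\times d$ blocks $A=\begin{pmatrix} A_{LL} & A_{LR} \\ A_{RL} & A_{RR} \end{pmatrix}$. Define $\Phi(z)=\Phi_A(z)=A_{LL}+A_{RR}+A_{LR}z+A_{RL}z^{-1}\in M_d(\mathbb{C})$ for $z\in\mathbb{C}^*$, $\mathcal{S}=\{z\in\mathbb{C}^*:\det\Phi(z)=0\}$, $\mathcal{S}_{<1}=\{w\in\mathcal{S}:|w|<1\}$, $\mathcal{S}_{>1}=\{w\in\mathcal{S}:|w|>1\}$. ($\Phi(z)$ is Hermitian positive definite for $|z|=1$, so $\mathcal{S}=\mathcal{S}_{<1}\sqcup\mathcal{S}_{>1}$.) Assumption I: $\mathrm{rank}(A_{LR})=d$. Assumption II: every $w\in\mathcal{S}$ is a simple root of the polynomial $z^d\det\Phi(z)$ and $\dim\ker\Phi(w)=1$. Under II, for each $w\in\mathcal{S}$ a vector $u_w\neq0$ spanning $\ker\Phi(w)$ is fixed. Under I and II, $(u_w)_{w\in\mathcal{S}_{<1}}$ and $(u_w)_{w\in\mathcal{S}_{>1}}$ are bases of $\mathbb{C}^d$. A matrix $B_R\in M_d(\mathbb{C})$ is right Schur-invariant for $A$ if $B_R\in H_d^+(\mathbb{C})$ and $B_R=A_{LL}-A_{LR}(A_{RR}+B_R)^{-1}A_{RL}$. For $\alpha,\beta>0$, $B\in H_d^+(\mathbb{C})$ and $x,y\in\mathbb{C}^d$: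 $\boldsymbol{e}_{\alpha,A}(x,y)=\alpha\exp\left(-\tfrac12\begin{pmatrix} x \\ y \end{pmatrix}^*A\begin{pmatrix} x \\ y \end{pmatrix}\right)$ and $\boldsymbol{e}'_{\beta,B}(x)=\beta\exp(-\tfrac12x^*Bx)$; $dy$ is Lebesgue measure on $\mathbb{C}^d\cong\mathbb{R}^{2d}$. *)

(* Defs.v *)
From HB Require Import structures.
From mathcomp Require Import all_boot all_order all_algebra.
From mathcomp Require Import sesquilinear spectral complex.
From mathcomp Require Import all_classical all_reals all_analysis.

Set Implicit Arguments.
Unset Strict Implicit.
Unset Printing Implicit Defensive.

Import Order.TTheory GRing.Theory Num.Theory numFieldNormedType.Exports.

Local Open Scope classical_set_scope.
Local Open Scope ring_scope.
Local Open Scope sesquilinear_scope.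
Local Open Scope complex_scope.

(* The topology of [R[i]] given by the modulus; the matrix spaces over [R[i]]
   then carry the usual (entrywise) topology. *)
HB.instance Definition _ (R : realType) := NormedModule.copy R[i] (R[i]^o).

Lemma product_sigma_finite d1 d2 (T1 : measurableType d1)
    (T2 : measurableType d2) (R : realType)
    (m1 : {sigma_finite_measure set T1 -> \bar R})
    (m2 : {sigma_finite_measure set T2 -> \bar R}) :
  sigma_finite setT (m1 \x m2)%E.
Proof.
have /sigma_finiteP[F [TF ndF Foo]] := sigma_finiteT m1.
have /sigma_finiteP[G [TG ndG Goo]] := sigma_finiteT m2.
exists (fun n => F n `*` G n).
  rewrite -setXTT TF TG predeqE => -[x y]; split.
    move=> [/= [n _ Fnx] [k _ Gky]]; exists (maxn n k) => //; split.
    - by move: x Fnx; exact/subsetPset/ndF/leq_maxl.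
    - by move: y Gky; exact/subsetPset/ndG/leq_maxr.
  by move=> [n _ []/= ? ?]; split; exists n.
move=> k; have [? ?] := Foo k; have [? ?] := Goo k.
split; first exact: measurableX.
by rewrite product_measure1E// lte_mul_pinfty// ge0_fin_numE.
Qed.

Section tuple_measure.
Context d (T : measurableType d) (R : realType).
Variable mu : {sigma_finite_measure set T -> \bar R}.

Definition tuple_cons n (p : T * n.-tuple T) : n.+1.-tuple T :=
  [tuple of p.1 :: p.2].

Lemma measurable_tuple_cons n : measurable_fun setT (@tuple_cons n).
Proof. exact: (measurable_cons (f := fst) (g := snd)). Qed.

Section step.
Variables (n : nat) (m : {sigma_finite_measure set (n.-tuple T) -> \bar R}).

Definition tuple_measureS : set (n.+1.-tuple T) -> \bar R :=
  pushforward (mu \x m)%E (@tuple_cons n).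

Let tuple_measureS0 : tuple_measureS set0 = 0%E.
Proof. by rewrite /tuple_measureS /pushforward preimage_set0 measure0. Qed.

Let tuple_measureS_ge0 A : (0 <= tuple_measureS A)%E.
Proof. by rewrite /tuple_measureS /pushforward; apply: integral_ge0 => x _ /=. Qed.

Let tuple_measureS_sigma_additive : semi_sigma_additive tuple_measureS.
Proof.
move=> F mF tF mUF.
apply: (measure_semi_sigma_additive (s := pushforward (mu \x m)%E (@tuple_cons n))) => //.
exact: measurable_tuple_cons.
Qed.

HB.instance Definition _ := isMeasure.Build _ _ _ tuple_measureS
  tuple_measureS0 tuple_measureS_ge0 tuple_measureS_sigma_additive.

Let tuple_measureS_sigma_finite : sigma_finite setT tuple_measureS.
Proof.
have [F UF Ffin] : sigma_finite setT (mu \x m)%E by exact: product_sigma_finite.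
pose g (t : n.+1.-tuple T) : T * n.-tuple T := (thead t, [tuple of behead t]).
have mg : measurable_fun setT g.
  apply/measurable_fun_pair; first exact: measurable_tnth.
  exact: measurable_behead.
have gK : cancel (@tuple_cons n) g.
  move=> [x t]; rewrite /g /tuple_cons; congr pair => //.
  by apply: val_inj.
exists (fun k => g @^-1` F k) => [|k].
  by rewrite -preimage_bigcup -UF preimage_setT.
have [mFk Fk] := Ffin k; split; first by rewrite -[X in measurable X]setTI; exact: mg.
rewrite /tuple_measureS /pushforward -comp_preimage.
rewrite (_ : g \o _ = id) ?preimage_id//; exact/funext.
Qed.

HB.instance Definition _ := Measure_isSigmaFinite.Build _ _ _ tuple_measureS
  tuple_measureS_sigma_finite.

End step.

(* The [n]-th power of [mu], a measure on the product sigma-algebra of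
   [n.-tuple T]. *)
Fixpoint tuple_measure n : {sigma_finite_measure set (n.-tuple T) -> \bar R} :=
  match n with
  | 0 => dirac ([tuple] : 0.-tuple T)
  | n'.+1 => tuple_measureS (tuple_measure n')
  end.

Lemma tuple_measure_box n (A : 'I_n -> set T) :
  (forall i, measurable (A i)) ->
  tuple_measure n [set t | forall i, A i (tnth t i)] = (\prod_(i < n) mu (A i))%E.
Proof.
elim: n A => [|n IHn] A mA /=.
  rewrite big_ord0 diracE mem_set//; by case.
rewrite big_ord_recl -IHn; last by move=> i.
rewrite /tuple_measureS /pushforward -product_measure1E//.
  congr (_ _); apply/seteqP; split => -[x t] /=.
    move=> At; split; first exact: (At ord0).
    move=> i; have := At (lift ord0 i); rewrite tnthS.
    by congr (A _ (tnth _ _)); apply: val_inj.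
  move=> [Ax At] i; case: (unliftP ord0 i) => [j|] ->//; rewrite tnthS.
  by have := At j; congr (A _ (tnth _ _)); apply: val_inj.
rewrite (_ : mkset _ = \bigcap_(i in [set: 'I_n])
   ((fun t : n.-tuple T => tnth t i) @^-1` A (lift ord0 i))).
  apply: fin_bigcap_measurable => // i _; rewrite -[X in measurable X]setTI.
  exact: measurable_tnth.
by apply/seteqP; split => t /= At i *; exact: At.
Qed.

End tuple_measure.

Section lebesgue_complex.
Variable R : realType.

Definition lebesgue2 : set (measurableTypeR R * measurableTypeR R) -> \bar R :=
  (@lebesgue_measure R \x @lebesgue_measure R)%E.

HB.instance Definition _ := Measure.on lebesgue2.
HB.instance Definition _ := Measure_isSigmaFinite.Build _ _ _ lebesgue2
  (product_sigma_finite _ _).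

(* Lebesgue measure on C^d = (R * R)^d = R^(2d). *)
Definition lebesgue_complex d :
    {sigma_finite_measure
       set (d.-tuple (measurableTypeR R * measurableTypeR R)) -> \bar R} :=
  tuple_measure lebesgue2 d.

Definition cvec d (t : d.-tuple (measurableTypeR R * measurableTypeR R)) :
    'cV[R[i]]_d :=
  \col_i ((tnth t i).1 +i* (tnth t i).2).

End lebesgue_complex.

Section gaussian_markov.
Variables (R : realType) (d : nat).
Local Notation C := R[i].

Definition hermitian_posdef n (A : 'M[C]_n) : Prop :=
  A \is hermsymmx /\
  forall v : 'cV[C]_n, v != 0 -> 0 < (v^t* *m A *m v) 0 0.

Implicit Types (A : 'M[C]_(d + d)) (B W : 'M[C]_d).

Definition blockLL A : 'M[C]_d := ulsubmx A.
Definition blockLR A : 'M[C]_d := ursubmx A.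
Definition blockRL A : 'M[C]_d := dlsubmx A.
Definition blockRR A : 'M[C]_d := drsubmx A.

Definition Phi A (z : C) : 'M[C]_d :=
  blockLL A + blockRR A + z *: blockLR A + z^-1 *: blockRL A.

(* z^d det Phi(z) = det (z Phi(z)), as a polynomial in z. *)
Definition detPhi_poly A : {poly C} :=
  \det ('X *: map_mx polyC (blockLL A + blockRR A)
        + 'X^2 *: map_mx polyC (blockLR A) + map_mx polyC (blockRL A)).

Lemma detPhi_polyE A (z : C) :
  z != 0 -> (detPhi_poly A).[z] = z ^+ d * \det (Phi A z).
Proof.
move=> z0; rewrite -detZ /detPhi_poly -[LHS]/(horner_eval z _) -det_map_mx.
congr (\det _); apply/matrixP => i j.
rewrite !mxE ![RHS]mulrDr.
rewrite -[LHS]/(_.[z]) 2!hornerD 2!hornerM hornerX hornerXn !hornerC.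
by congr (_ + _); [rewrite [RHS]mulrDr mulrA expr2 | rewrite mulVKf].
Qed.

Definition zeros A : set C := [set z | z != 0 /\ \det (Phi A z) = 0].
Definition zeros_lt1 A : set C := [set w | zeros A w /\ `|w| < 1].

Definition assumptionI A : Prop := \rank (blockLR A) = d.

(* The column space of [cokermx M] is the kernel of [v |-> M *m v]. *)
Definition assumptionII A : Prop :=
  forall w, zeros A w ->
    mup w (detPhi_poly A) = 1%N /\ \rank (cokermx (Phi A w)) = 1%N.

Definition spans_kernels A (u : C -> 'cV[C]_d) : Prop :=
  forall w, zeros A w ->
    u w != 0 /\
    forall v : 'cV[C]_d, Phi A w *m v = 0 <-> exists c, v = c *: u w.

Definition is_basis_on (S : set C) (u : C -> 'cV[C]_d) : Prop :=
  exists s : seq C,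
    [/\ uniq s, forall w, w \in s <-> S w & basis_of fullv (map u s)].

Definition right_schur_invariant A B : Prop :=
  hermitian_posdef B /\
  B = blockLL A - blockLR A *m invmx (blockRR A + B) *m blockRL A.

Definition dirichlet_solution A (x0 : 'cV[C]_d) (x : nat -> 'cV[C]_d) : Prop :=
  [/\ forall k, (0 < k)%N ->
        blockRL A *m x k.-1 + (blockLL A + blockRR A) *m x k
        + blockLR A *m x k.+1 = 0,
      x 0%N = x0
    & x @ \oo --> (0 : 'cV[C]_d)].

(* The quadratic forms below are real for Hermitian matrices, so taking real
   parts discards nothing. *)
Definition gauss2 (alpha : R) A (x y : 'cV[C]_d) : R :=
  alpha * expR (- 2^-1 *
    complex.Re (((col_mx x y)^t* *m A *m col_mx x y) 0 0)).

Definition gauss1 (beta : R) B (x : 'cV[C]_d) : R :=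
  beta * expR (- 2^-1 * complex.Re ((x^t* *m B *m x) 0 0)).

End gaussian_markov.

(* Main.v *)
Require Import Defs.
From mathcomp Require Import all_boot all_order all_algebra.
From mathcomp Require Import sesquilinear spectral complex.
From mathcomp Require Import all_classical all_reals all_analysis.
From mathcomp Require Import measurable_realfun.
From mathcomp Require Import ring zify.
Set Implicit Arguments.
Unset Strict Implicit.
Import Order.TTheory GRing.Theory Num.Theory numFieldNormedType.Exports.
Local Open Scope classical_set_scope.
Local Open Scope ring_scope.
Local Open Scope complex_scope.

(* Each of (i), (ii), (iii) forces the quadratic matrix equation
   [A_RL + (A_LL + A_RR) W + A_LR W^2 = 0] and puts the spectrum of [W] inside
   the unit disc. The eigenvectors of such a [W] lie in the kernels of [Phi(w)],
   [w] in [S_<1]; these kernels are lines and there are exactly [d] such [w], so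
   [W] is determined. Positivity comes from an energy argument: for a decaying
   solution [x_k] of the three-term recurrence, summation by parts turns
   [sum_k (x_k, x_(k+1))* A (x_k, x_(k+1))] into the boundary term
   [x_0* (A_LL x_0 + A_LR x_1)], which is [x_0* B_R x_0] for [x_k = W^k x_0].
   The same identity with [x_0 = 0] shows that the [u_w] are independent. For
   the eigenvalue, completing the square in [y] leaves [(2 pi)^d / det M] with
   [M = A_RR + B_R], and the quadratic equation reads [M W = - A_RL]. *)

(** * Limits of complex sequences *)

Section complex_limits.
Local Open Scope sesquilinear_scope.
Context {R : realType}.
Local Notation C := R[i].

Lemma mx_cvg0P m n (x : nat -> 'M[C]_(m, n)) :
  x @ \oo --> (0 : 'M[C]_(m, n)) <->
  forall i j, (fun k => x k i j) @ \oo --> (0 : C).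
Proof.
split=> [x0 i j|x0].
  apply/cvg_ballP => e e0.
  move/cvg_ballP : x0 => /(_ e e0).
  apply: filterS => k [_ /(_ i j)]; by rewrite mxE.
apply/cvg_ballP => e e0.
have : \forall k \near \oo, forall i j, ball (0 : C) e (x k i j).
  apply: filter_forall => i; apply: filter_forall => j.
  by move/cvg_ballP : (x0 i j) => /(_ e e0).
by apply: filterS => k xk; split=> // i j; rewrite mxE.
Qed.

Lemma cvg0_norm (u v : nat -> C) :
  (forall n, `|v n| = `|u n|) -> u @ \oo --> (0 : C) -> v @ \oo --> (0 : C).
Proof.
move=> uv /cvgr0Pnorm_lt u0; apply/cvgr0Pnorm_lt => e e0.
by apply: filterS (u0 e e0) => k; rewrite uv.
Qed.

(** Radii in [C] are complex numbers [e] with [0 < e], hence real, so the claim reduces to the real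
    geometric sequence of ratio [|z|]. *)
Lemma cvg0_norm_lt1 (z : C) :
  `|z| < 1 -> (fun n => z ^+ n) @ \oo --> (0 : C).
Proof.
have [r zr] : exists r : R, `|z| = r%:C.
  by exists (complex.Re `|z|); rewrite normc_def.
have r0 : 0 <= r by rewrite -ler0c -zr.
rewrite zr -[1]/(1%:C) ltcR => r1.
apply/cvgr0Pnorm_lt => e; rewrite ltcE => /andP[/= /eqP ei er].
have : `|r| < 1 by rewrite ger0_norm.
move/cvg_expr => /cvgr0Pnorm_lt /(_ _ er); apply: filterS => k.
rewrite normrX ger0_norm// => rk.
suff : (r ^+ k)%:C < e by rewrite rmorphXn/= -zr -normrX.
by rewrite ltcE/= ei eqxx.
Qed.

(** In the partial order of [C], [s n <= u] says that the imaginary parts agree and the real parts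
    are ordered, so the limit [0] also kills the imaginary part of [u]. Forms not yet known to be
    real can thus be compared. *)
Lemma ge0_of_cvg0 (u : C) (s : nat -> C) :
  s @ \oo --> (0 : C) -> (forall n, s n <= u) -> 0 <= u.
Proof.
move=> /cvgr0Pnorm_lt s0 su; rewrite lecE.
have key e : 0 < e -> exists n, `|s n| < e%:C.
  move=> e0; have /s0 [n _ /(_ n)] : 0 < e%:C :> C by rewrite ltcR.
  by move=> /(_ (leqnn n)) h; exists n.
have small (x e : R) (y : C) : `|x|%:C <= `|y| -> `|y| < e%:C -> `|x| < e.
  by move=> xy ye; rewrite -ltcR; apply: le_lt_trans ye.
have Imle (z : C) : `|complex.Im z|%:C <= `|z|.
  (* Up to sign, the imaginary part of [z] is the real part of ['i * z]. *)
  have := normc_ge_Re ('i * z); rewrite normrM.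
  rewrite [`|'i|]normc_def/= expr0n/= add0r expr1n sqrtr1 mul1r.
  by case: (z) => a b; simpc; rewrite normrN.
apply/andP; split.
- apply/eqP/normr0_eq0/eqP; rewrite eq_le normr_ge0 andbT.
  apply/ler_addgt0Pl => e e0; rewrite addr0.
  have [n sn] := key _ e0; have := su n; rewrite lecE => /andP[/eqP -> _].
  exact/ltW/(small _ _ _ (Imle _) sn).
- rewrite /=; apply/ler_addgt0Pl => e e0.
  have [n sn] := key _ e0; have := su n; rewrite lecE => /andP[_ su'].
  have := small _ _ _ (normc_ge_Re _) sn => /ltr_normlP[+ _].
  rewrite -lerBlDr sub0r => /ltW; apply: le_trans; by rewrite lerN2.
Qed.

Lemma cvg0_sum n (f : 'I_n -> nat -> C) :
  (forall i, f i @ \oo --> (0 : C)) ->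
  (fun k => \sum_i f i k) @ \oo --> (0 : C).
Proof.
move=> f0; elim: (index_enum _) => [|i r IHr].
  by under eq_fun do rewrite big_nil; exact: cvg_cst.
under eq_fun do rewrite big_cons.
by have := cvgD (f0 i) IHr; rewrite addr0 => h; exact: h.
Qed.

Lemma cvg0Mr (f : nat -> C) (a : C) :
  f @ \oo --> (0 : C) -> (fun k => f k * a) @ \oo --> (0 : C).
Proof. by move=> /cvgMr_tmp-/(_ a); rewrite mul0r. Qed.

Lemma cvg0M (f g : nat -> C) : f @ \oo --> (0 : C) -> g @ \oo --> (0 : C) ->
  (fun k => f k * g k) @ \oo --> (0 : C).
Proof. by move=> f0 /(cvgM f0); rewrite mul0r. Qed.

End complex_limits.

(** * Positive definite matrices and the Stein equation *)

Section positive_definite.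
Local Open Scope sesquilinear_scope.
Context {R : realType}.
Local Notation C := R[i].

Lemma ctmxM m n p (M : 'M[C]_(m, n)) (N : 'M[C]_(n, p)) :
  (M *m N)^t* = N^t* *m M^t*.
Proof. by rewrite trmx_mul map_mxM. Qed.

Lemma ctmxD m n (M N : 'M[C]_(m, n)) : (M + N)^t* = M^t* + N^t*.
Proof. by rewrite linearD map_mxD. Qed.

Lemma ctmxB m n (M N : 'M[C]_(m, n)) : (M - N)^t* = M^t* - N^t*.
Proof. by rewrite linearB map_mxB. Qed.

Lemma ctmxZ m n a (M : 'M[C]_(m, n)) : (a *: M)^t* = Num.conj a *: M^t*.
Proof. by rewrite linearZ map_mxZ. Qed.

Lemma hermsymmxP n (M : 'M[C]_n) : M \is hermsymmx <-> M^t* = M.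
Proof.
rewrite -[M^t*]scale1r -(expr0 (-1)); split=> [/is_hermitianmxP <-//|h].
exact/is_hermitianmxP.
Qed.

Lemma posdef_ge0 n (M : 'M[C]_n) (v : 'cV[C]_n) :
  hermitian_posdef M -> 0 <= (v^t* *m M *m v) 0 0.
Proof.
move=> [_ Mpos]; have [->|/Mpos/ltW//] := eqVneq v 0.
by rewrite mulmx0 mxE.
Qed.

Lemma posdef_eq0 n (M : 'M[C]_n) (v : 'cV[C]_n) :
  hermitian_posdef M -> (v^t* *m M *m v) 0 0 <= 0 -> v = 0.
Proof.
move=> [_ Mpos] vle; apply/eqP/negPn/negP => /Mpos.
by move=> /lt_le_trans/(_ vle); rewrite ltxx.
Qed.

Lemma unitmx_col_inj n (M : 'M[C]_n) :
  (forall v : 'cV[C]_n, M *m v = 0 -> v = 0) -> M \in unitmx.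
Proof.
move=> Minj; rewrite -unitmx_tr -row_free_unit.
apply/inj_row_free => v /(congr1 trmx); rewrite trmx_mul trmxK trmx0 => /Minj.
by move=> /(congr1 trmx); rewrite trmxK trmx0.
Qed.

Lemma posdef_unit n (M : 'M[C]_n) : hermitian_posdef M -> M \in unitmx.
Proof.
move=> Mpos; apply: unitmx_col_inj => v Mv.
by apply: posdef_eq0 Mpos _; rewrite -mulmxA Mv mulmx0 mxE.
Qed.

(* Telescoping: [c* S c - (D^n c)* S (D^n c)] is the sum of the [G]-forms of
   [c], D c, ..., D^(n-1) c. *)
Lemma stein_ge n (S G D : 'M[C]_n) :
  G = S - D^t* *m S *m D ->
  (forall v : 'cV[C]_n, 0 <= (v^t* *m G *m v) 0 0) ->
  forall c : 'cV[C]_n, (fun k => D ^+ k *m c) @ \oo --> (0 : 'cV[C]_n) ->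
  (c^t* *m G *m c) 0 0 <= (c^t* *m S *m c) 0 0.
Proof.
move=> GE G0 c Dc0.
pose q (v : 'cV[C]_n) : C := (v^t* *m S *m v) 0 0.
pose s k := q (D ^+ k *m c).
have qG (v : 'cV[C]_n) : (v^t* *m G *m v) 0 0 = q v - q (D *m v).
  rewrite GE mulmxBr mulmxBl mxE [X in _ + X]mxE.
  congr (_ - fun_of_matrix _ _ _).
  by rewrite ctmxM !mulmxA.
have sS k : s k - s k.+1 = (((D ^+ k *m c)^t* *m G *m (D ^+ k *m c)) 0 0 : C).
  by rewrite qG /s exprS mulmxA.
have s0 : s @ \oo --> (0 : C).
  have /mx_cvg0P Dc := Dc0.
  rewrite (_ : s = fun k => \sum_j
      (\sum_i Num.conj ((D ^+ k *m c) i 0) * S i j) * (D ^+ k *m c) j 0);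
    last first.
    apply/funext => k; rewrite /s /q !mxE; apply: eq_bigr => j _; rewrite !mxE.
    by congr (_ * _); apply: eq_bigr => i _; rewrite !mxE.
  apply: cvg0_sum => j; apply: cvg0M; last exact: Dc.
  apply: cvg0_sum => i; apply: cvg0Mr.
  by apply: cvg0_norm (Dc i 0) => k; rewrite norm_conjC.
(* The difference of the two sides is [s 1], which bounds the decreasing sequence [s] only from
   index [1] on; hence the shift. *)
rewrite -subr_ge0; apply: (ge0_of_cvg0 (s := s \o succn)).
  by rewrite (cvg_shiftS s).
have -> : (c^t* *m S *m c) 0 0 = s 0%N by rewrite /s expr0 mul1mx.
have -> : (c^t* *m G *m c) 0 0 = s 0%N - s 1%N by rewrite sS expr0 mul1mx.
move=> k /=; rewrite opprB addrC subrK.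
elim: k => [|k IH]; first exact: lexx.
by apply: (le_trans _ IH); rewrite -subr_ge0 (sS k.+1); exact: G0.
Qed.

End positive_definite.

(** * The matrix pencil *)

Section matrix_pencil.
Local Open Scope sesquilinear_scope.
Context {R : realType} {d : nat} (A : 'M[R[i]]_(d + d)).
Context (hA : hermitian_posdef A).
Local Notation C := R[i].
Local Notation LL := (blockLL A).
Local Notation LR := (blockLR A).
Local Notation RL := (blockRL A).
Local Notation RR := (blockRR A).

Let ctmxA : A^t* = A. Proof. by have [/hermsymmxP] := hA. Qed.

Lemma ctmx_blockLL : LL^t* = LL.
Proof. by rewrite trmx_ulsub map_ulsubmx ctmxA. Qed.

Lemma ctmx_blockLR : LR^t* = RL.
Proof. by rewrite trmx_ursub map_dlsubmx ctmxA. Qed.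

Lemma ctmx_blockRL : RL^t* = LR.
Proof. by rewrite trmx_dlsub map_ursubmx ctmxA. Qed.

Lemma ctmx_blockRR : RR^t* = RR.
Proof. by rewrite trmx_drsub map_drsubmx ctmxA. Qed.

Lemma addrCAC (V : zmodType) (a b c e : V) :
  a + c + (b + e) = a + (b + c) + e.
Proof. by rewrite [b + c]addrC !addrA. Qed.

Lemma quad_block m (X Y : 'M[C]_(d, m)) :
  (col_mx X Y)^t* *m A *m col_mx X Y
  = X^t* *m (LL *m X + LR *m Y) + Y^t* *m (RL *m X + RR *m Y).
Proof.
by rewrite tr_col_mx map_row_mx -mulmxA -{1}[A]submxK mul_block_col mul_row_col.
Qed.

(* When [D^k] tends to [0], the form of [S] at [c] is the energy
   [sum_k (x_k, x_(k+1))* A (x_k, x_(k+1))] of the solution [x_k = X D^k c] of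
   the three-term recurrence, summed by parts down to its boundary term. *)
Lemma solvent_stein m (X : 'M[C]_(d, m)) (D : 'M[C]_m) :
  RL *m X + (LL + RR) *m (X *m D) + LR *m (X *m D *m D) = 0 ->
  let S := X^t* *m (LL *m X + LR *m (X *m D)) in
  (col_mx X (X *m D))^t* *m A *m col_mx X (X *m D) = S - D^t* *m S *m D.
Proof.
move=> H S; rewrite quad_block; congr (_ + _).
(* By the recurrence, the lower half of [A (X, X D)] is minus the upper half moved one step by
   [D]. *)
rewrite (_ : RL *m X + _ = - ((LL *m X + LR *m (X *m D)) *m D)); last first.
  apply/eqP; rewrite -addr_eq0 -[X in _ == X]H mulmxDl mulmxDl !mulmxA.
  by apply/eqP; exact: addrCAC.
by rewrite mulmxN /S ctmxM !mulmxA.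
Qed.

(** Multiplying by [w] clears the pole; the result says that [w^k v] solves the three-term
    recurrence. *)
Lemma Phi_kernel w (v : 'cV[C]_d) : w != 0 ->
  Phi A w *m v = 0 <->
  RL *m v + w *: ((LL + RR) *m v) + w ^+ 2 *: (LR *m v) = 0.
Proof.
move=> w0; rewrite -[X in _ <-> X = 0](_ : w *: (Phi A w *m v) = _).
  split=> [->|/eqP]; first by rewrite scaler0.
  by rewrite scaler_eq0 (negbTE w0) => /eqP.
rewrite /Phi !mulmxDl -!scalemxAl !scalerDr !scalerA mulfV// scale1r -expr2.
by rewrite addrC addrA.
Qed.

Lemma zeros_kernel w : zeros A w <->
  w != 0 /\ exists2 v : 'cV[C]_d, v != 0 & Phi A w *m v = 0.
Proof.
split=> -[w0 h]; split=> //.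
  have /eqP/det0P[v v0 vP] : \det (Phi A w)^T = 0 by rewrite det_tr.
  exists v^T; first by rewrite trmx_eq0.
  by rewrite -[LHS]trmxK trmx_mul trmxK vP trmx0.
have [v v0 vP] := h; rewrite -det_tr; apply/eqP/det0P; exists v^T.
  by rewrite trmx_eq0.
by rewrite -trmx_mul vP trmx0.
Qed.

(** Conjugate transposition exchanges [LR] and [RL], which reflects the variable in the unit
    circle. *)
Lemma ctmx_Phi w : (Phi A w)^t* = Phi A (Num.conj w)^-1.
Proof.
rewrite /Phi !ctmxD !ctmxZ ctmx_blockLL ctmx_blockLR ctmx_blockRL ctmx_blockRR.
by rewrite fmorphV invrK; exact: addrAC.
Qed.

Lemma zeros_conjV w : zeros A w -> zeros A (Num.conj w)^-1.
Proof.
move=> [w0 Pw]; split; first by rewrite invr_eq0 conjC_eq0.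
by rewrite -ctmx_Phi -map_trmx det_tr det_map_mx Pw rmorph0.
Qed.

(** For [|w| = 1] the form of [A] at [(v, w v)] equals [v^* Phi(w) v], so a kernel vector would
    contradict the positivity of [A]. *)
Lemma zeros_norm_neq1 w : zeros A w -> `|w| != 1.
Proof.
move=> /zeros_kernel[w0 [v v0 Pv]]; apply/eqP => w1.
have wV : Num.conj w = w^-1.
  by apply: (mulfI w0); rewrite mulfV// -normCK w1 expr1n.
have : col_mx v (w *: v) = 0.
  apply: posdef_eq0 hA _; rewrite quad_block ctmxZ wV.
  rewrite (_ : _ + _ = v^t* *m (Phi A w *m v)); first by rewrite Pv mulmx0 mxE.
  rewrite -[(w^-1 *: _) *m _]scalemxAl scalemxAr -mulmxDr. congr (_ *m _).
  rewrite /Phi !mulmxDl -!scalemxAl -!scalemxAr scalerDr scalerA mulVf//.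
  rewrite scale1r.
  by rewrite -!addrA; congr (_ + _); rewrite [LHS]addrA [LHS]addrC.
by move=> /eqP; rewrite col_mx_eq0 (negbTE v0).
Qed.

Lemma diag_mx_expr m (t : 'rV[C]_m) k :
  diag_mx t ^+ k = diag_mx (\row_j t 0 j ^+ k).
Proof.
elim: k => [|k IH].
  by rewrite expr0 -[1]/(1%:M); apply/matrixP => i j; rewrite !mxE expr0.
rewrite exprS IH -[_ * _]/(_ *m _) mulmx_diag; congr diag_mx.
by apply/rowP => j; rewrite !mxE exprS.
Qed.

Lemma diag_mx_expr_cvg0 m (t : 'rV[C]_m) (c : 'cV[C]_m) :
  (forall j, `|t 0 j| < 1) ->
  (fun k => diag_mx t ^+ k *m c) @ \oo --> (0 : 'cV[C]_m).
Proof.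
move=> t1; apply/mx_cvg0P => i j.
under eq_fun do rewrite diag_mx_expr mul_diag_mx !mxE.
exact/cvg0Mr/cvg0_norm_lt1.
Qed.

(** Vanishing against powers extends to all polynomials; the product of the [X - t i] with [i != j]
    then isolates [a j]. *)
Lemma power_sums_eq0 m (a t : 'I_m -> C) : injective t ->
  (forall k, \sum_j a j * t j ^+ k = 0) -> forall j, a j = 0.
Proof.
move=> tinj at0 j.
have poly0 (p : {poly C}) : \sum_i a i * p.[t i] = 0.
  under eq_bigr do rewrite horner_coef mulr_sumr.
  rewrite exchange_big big1//= => k _.
  under eq_bigr do rewrite mulrCA.
  by rewrite -mulr_sumr at0 mulr0.
have := poly0 (\prod_(i | i != j) ('X - (t i)%:P)).
rewrite (bigD1 j)//= [X in _ + X]big1 ?addr0 => [/eqP|i ij]; last first.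
  by rewrite horner_prod (bigD1 i)//= hornerXsubC subrr mul0r mulr0.
rewrite mulf_eq0 horner_prod prodf_seq_eq0 => /orP[/eqP//|/hasP[i _ /andP[ij]]].
by rewrite hornerXsubC subr_eq0 => /eqP/tinj ji; rewrite ji eqxx in ij.
Qed.

Definition kernel_mx (u : C -> 'cV[C]_d) m (t : 'I_m -> C) : 'M[C]_(d, m) :=
  \matrix_(i, j) u (t j) i 0.

Lemma kernel_mx_solvent (u : C -> 'cV[C]_d) m (t : 'I_m -> C) :
  spans_kernels A u -> (forall j, zeros A (t j)) ->
  let X := kernel_mx u t in let D := diag_mx (\row_j t j) in
  RL *m X + (LL + RR) *m (X *m D) + LR *m (X *m D *m D) = 0.
Proof.
move=> hu ht X D; apply/matrixP => i j.
have [w0 _] := ht j; have [_ uP] := hu _ (ht j).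
have /Phi_kernel-/(_ w0)/matrixP/(_ i 0) : Phi A (t j) *m u (t j) = 0.
  by apply/uP; exists 1; rewrite scale1r.
rewrite /X /D !mul_mx_diag !mxE => H; rewrite -[RHS]H; congr (_ + _ + _).
- by apply: eq_bigr => k _; rewrite !mxE.
- by rewrite mulr_sumr; apply: eq_bigr => k _; rewrite !mxE mulrA mulrC.
- rewrite mulr_sumr; apply: eq_bigr => k _.
  by rewrite !mxE; ring.
Qed.

(* For [X c = 0] the solution [x_k = X D^k c] has zero energy, so it vanishes
   identically, and [power_sums_eq0] separates the modes. *)
Lemma kernel_mx_inj (u : C -> 'cV[C]_d) m (t : 'I_m -> C) :
  spans_kernels A u -> injective t -> (forall j, zeros_lt1 A (t j)) ->
  forall c : 'cV[C]_m, kernel_mx u t *m c = 0 -> c = 0.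
Proof.
move=> hu tinj ht c; set X := kernel_mx u t => Xc0.
have hz j : zeros A (t j) by have [] := ht j.
pose D := diag_mx (\row_j t j).
have step (b : 'cV[C]_m) : X *m b = 0 -> X *m (D *m b) = 0.
  move=> Xb.
  have GE := solvent_stein (kernel_mx_solvent hu hz).
  have quadE (e : 'cV[C]_m) :
      e^t* *m ((col_mx X (X *m D))^t* *m A *m col_mx X (X *m D)) *m e
      = (col_mx X (X *m D) *m e)^t* *m A *m (col_mx X (X *m D) *m e).
    by rewrite ctmxM !mulmxA.
  have G0 (e : 'cV[C]_m) :
      0 <= (e^t* *m ((col_mx X (X *m D))^t* *m A *m col_mx X (X *m D))
            *m e) 0 0.
    by rewrite quadE; exact: posdef_ge0.
  have D0 : (fun k => D ^+ k *m b) @ \oo --> (0 : 'cV[C]_m).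
    by apply: diag_mx_expr_cvg0 => j; rewrite mxE; have [] := ht j.
  have := stein_ge GE G0 D0; rewrite quadE.
  (* The boundary term begins with the adjoint of [X b = 0], so the energy of [(X b, X D b)] is at
     most [0]. *)
  have -> : b^t* *m (X^t* *m (LL *m X + LR *m (X *m D))) *m b = 0.
    by rewrite [b^t* *m _]mulmxA -ctmxM Xb trmx0 map_mx0 !mul0mx.
  rewrite [X in _ <= X]mxE => /(posdef_eq0 hA)/eqP.
  by rewrite mul_col_mx col_mx_eq0 mulmxA => /andP[_ /eqP].
have XD k : X *m (D ^+ k *m c) = 0.
  elim: k => [|k IH]; first by rewrite expr0 mul1mx.
  by rewrite exprS -[_ * _]/(_ *m _) -mulmxA; exact: step.
apply/colP => j; rewrite [RHS]mxE.
have uc i : u (t j) i 0 * c j 0 = 0.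
  apply: (power_sums_eq0 (a := fun j => u (t j) i 0 * c j 0) tinj) => k.
  have /matrixP/(_ i 0) := XD k; rewrite !mxE => H; rewrite -[RHS]H.
  apply: eq_bigr => l _.
  by rewrite diag_mx_expr mul_diag_mx !mxE -mulrA [c l 0 * _]mulrC.
have [/eqP u0 _] := hu _ (hz j).
apply: contra_notP u0 => /eqP cj; apply/colP => i; rewrite mxE.
by apply: (mulIf cj); rewrite mul0r uc.
Qed.

End matrix_pencil.

(** * Zeros inside the unit disc *)

(** In degree [n * k] only the coefficients of degree [k] of the factors meet. With [k = 2], applied
    to each Leibniz term, this identifies the coefficient of [z^(2d)] in [detPhi_poly A] as
    [det LR]. *)
Lemma coef_prod_top (F : comNzRingType) n k (p : 'I_n -> {poly F}) :
  (forall i, (size (p i) <= k.+1)%N) ->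
  (size (\prod_i p i)%R <= (n * k).+1)%N /\
  (\prod_i p i)`_(n * k) = \prod_i (p i)`_k.
Proof.
elim: n p => [|n IH] p hp; first by rewrite !big_ord0 size_poly1 coef1.
have [hs hc] := IH (fun i => p (lift ord0 i)) (fun i => hp _).
rewrite !big_ord_recl mulSn.
have hp0 := hp ord0.
split.
  apply: leq_trans (size_polyMleq _ _) _.
  move: hp0 hs; set a := size _; set b := size _. lia.
have k_lt : (k < (k + n * k).+1)%N by rewrite ltnS leq_addr.
rewrite coefM (bigD1 (Ordinal k_lt))//=.
rewrite addKn hc [X in _ + X]big1 ?addr0// => -[i /= ik] /eqP/val_eqP /=.
rewrite neq_ltn => /orP[lt|lt].
  rewrite [X in _ * X]nth_default ?mulr0//; apply: leq_trans hs _; lia.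
by rewrite nth_default ?mul0r// (leq_trans hp0).
Qed.

Section zeros_count.
Local Open Scope sesquilinear_scope.
Context {R : realType} {d : nat} (A : 'M[R[i]]_(d + d)).
Context (hA : hermitian_posdef A) (hI : assumptionI A).
Local Notation C := R[i].
Local Notation LL := (blockLL A).
Local Notation LR := (blockLR A).
Local Notation RL := (blockRL A).
Local Notation RR := (blockRR A).

Lemma blockLR_unit : LR \in unitmx.
Proof. by rewrite -row_free_unit /row_free hI. Qed.

Lemma blockRL_unit : RL \in unitmx.
Proof. by rewrite -(ctmx_blockLR hA) map_unitmx unitmx_tr blockLR_unit. Qed.

Lemma detPhi_poly_top : (size (detPhi_poly A) <= (d * 2).+1)%N /\
  (detPhi_poly A)`_(d * 2) = \det LR.
Proof.
rewrite /detPhi_poly.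
set M : 'M[{poly C}]_d := (X in \det X).
have ME i j :
    M i j = 'X * ((LL + RR) i j)%:P + 'X^2 * (LR i j)%:P + (RL i j)%:P.
  by rewrite !mxE.
have sM i j : (size (M i j) <= 3)%N.
  rewrite ME; apply/leq_sizeP => k k3; rewrite !coefD coefXM coefXnM !coefC.
  by case: k k3 => [|[|[|k]]]//= _; rewrite !addr0.
have cM i j : (M i j)`_2 = LR i j.
  by rewrite ME !coefD coefXM coefXnM !coefC/= !(addr0, add0r).
split.
  apply: (leq_trans (size_sum _ _ _)); apply/bigmax_leqP => s _.
  have [h _] := coef_prod_top (fun i => sM i (perm.fun_of_perm s i)).
  by rewrite mulr_sign; case: ifP => _; rewrite ?size_polyN.
rewrite coef_sum; apply: eq_bigr => s _.
have [_ h] := coef_prod_top (fun i => sM i (perm.fun_of_perm s i)).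
rewrite -(eq_bigr _ (fun i _ => cM i (perm.fun_of_perm s i))) -h !mulr_sign.
by case: ifP => _; rewrite ?coefN.
Qed.

Lemma detPhi_poly0 : (detPhi_poly A).[0] = \det RL.
Proof.
rewrite /detPhi_poly -[LHS]/(horner_eval 0 _) -det_map_mx; congr (\det _).
apply/matrixP => i j; rewrite !mxE -[LHS]/(_.[0]) !hornerE/=.
by rewrite ?expr0n/= ?(mul0r, add0r).
Qed.

(** The constant term [det RL] is nonzero, so clearing the pole of [Phi] creates no root at [0]. *)
Lemma zeros_root w : zeros A w <-> root (detPhi_poly A) w.
Proof.
rewrite /root; split=> [[w0 Pw]|/eqP rw].
  by rewrite detPhi_polyE// Pw mulr0.
have w0 : w != 0.
  apply/eqP => w0; move: rw; rewrite w0 detPhi_poly0 => /eqP.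
  by rewrite -[_ == _]negbK -unitfE -unitmxE blockRL_unit.
split=> //; move/eqP: rw; rewrite detPhi_polyE// mulf_eq0 expf_eq0.
by rewrite (negbTE w0) andbF => /eqP.
Qed.

Context (hII : assumptionII A).

(* [z^d det Phi(z)] has degree exactly [2d] and simple roots, none on the unit
   circle; [w |-> 1/conj w] exchanges the inside and the outside. *)
Lemma zeros_lt1_tuple : exists2 t : d.-tuple C,
  uniq t & forall w, w \in t <-> zeros_lt1 A w.
Proof.
have [top topE] := detPhi_poly_top.
have detLR : \det LR != 0 by rewrite -unitfE -unitmxE blockLR_unit.
have sz : size (detPhi_poly A) = (d * 2).+1.
  apply/eqP; rewrite eqn_leq top/= ltnNge; apply/negP => h.
  by move/negP: detLR; rewrite -topE nth_default ?eqxx.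
have [r pE] := closed_field_poly_normal (detPhi_poly A).
have p0 : detPhi_poly A != 0 by rewrite -size_poly_eq0 sz.
have lc0 : lead_coef (detPhi_poly A) != 0 by rewrite lead_coef_eq0.
have szr : size r = (d * 2)%N.
  by move: sz; rewrite pE size_scale// size_prod_XsubC => -[].
have rP w : w \in r <-> zeros A w.
  by rewrite zeros_root pE rootZ// root_prod_XsubC.
(* The number of occurrences of [w] in [r] is its multiplicity as a root, which Assumption II makes
   [1]. *)
have ur : uniq r.
  apply: count_mem_uniq => w.
  have [wr|wr] := boolP (w \in r); last by apply/count_memPn.
  have [+ _] := hII (proj1 (rP w) wr).
  by rewrite pE -mul_polyC mupMr ?mu_prod_XsubC ?rootC.
pose f (w : C) := (Num.conj w)^-1.
have fK : involutive f by move=> w; rewrite /f fmorphV invrK; exact: conjCK.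
have fI := can_inj fK.
have fr w : w \in r -> f w \in r by move=> /rP/zeros_conjV-/(_ hA)/rP.
have fnorm w : `|f w| = `|w|^-1 by rewrite normfV norm_conjC.
pose ri := [seq w <- r | `|w| < 1]; pose ro := [seq w <- r | 1 < `|w|].
have r_gt0 w : w \in r -> 0 < `|w| by move=> /rP[w0 _]; rewrite normr_gt0.
have le1 : (size ri <= size ro)%N.
  rewrite -(size_map f); apply: uniq_leq_size.
    by rewrite map_inj_uniq// filter_uniq.
  move=> _ /mapP[w + ->]; rewrite !mem_filter => /andP[w1 wr].
  by rewrite fr// andbT fnorm invf_gt1// r_gt0.
have le2 : (size ro <= size ri)%N.
  rewrite -(size_map f); apply: uniq_leq_size.
    by rewrite map_inj_uniq// filter_uniq.
  move=> _ /mapP[w + ->]; rewrite !mem_filter => /andP[w1 wr].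
  by rewrite fr// andbT fnorm invf_lt1// r_gt0.
have tot : (size ri + size ro)%N = (d * 2)%N.
  rewrite -szr !size_filter -(count_predC (fun w => `|w| < 1) r); congr addn.
  apply: eq_in_count => w /rP /= wz; have := zeros_norm_neq1 hA wz.
  by rewrite -real_leNgt ?normr_real// lt_def eq_sym => ->.
have szri : size ri == d by apply/eqP; lia.
exists (Tuple szri); first exact: filter_uniq.
move=> w; rewrite /= mem_filter; split=> [/andP[w1 /rP wz]//|[/rP -> ->]//].
Qed.

End zeros_count.

(** * Solvents of the quadratic matrix equation *)

Section invariant_solvents.
Local Open Scope sesquilinear_scope.
Context {R : realType} {d : nat} (A : 'M[R[i]]_(d + d)).
Context (hA : hermitian_posdef A) (hI : assumptionI A).
Context (hII : assumptionII A).
Context (u : R[i] -> 'cV[R[i]]_d).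
Context (hu : spans_kernels A u).
Local Notation C := R[i].
Local Notation LL := (blockLL A).
Local Notation LR := (blockLR A).
Local Notation RL := (blockRL A).
Local Notation RR := (blockRR A).

Definition solvent (W : 'M[C]_d) := RL + (LL + RR) *m W + LR *m (W *m W) = 0.

Lemma kernel_basis_unit (t : d.-tuple C) :
  uniq t -> (forall w, w \in t -> zeros_lt1 A w) ->
  kernel_mx u (tnth t) \in unitmx.
Proof.
move=> ut ht; apply: unitmx_col_inj.
apply: (kernel_mx_inj hA hu); first exact/tuple_uniqP.
by move=> j; apply: ht; exact: mem_tnth.
Qed.

Lemma kernel_basis : is_basis_on (zeros_lt1 A) u.
Proof.
have [t ut ht] := zeros_lt1_tuple hA hI hII.
exists t; split=> //.
rewrite basisEfree subvf dimvf size_map size_tuple [X in (X <= _)%N]muln1 leqnn.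
rewrite !andbT -[map u t]/(tval [tuple of map u t]).
apply/freeP => k k0 i.
have Xu := kernel_basis_unit ut (fun w => proj1 (ht w)).
suff /colP/(_ i) : \col_j k j = 0 :> 'cV[C]_d by rewrite !mxE.
rewrite -(mulKmx Xu (\col_j k j)) [X in _ *m X](_ : _ = 0) ?mulmx0//.
rewrite -[RHS]k0; apply/colP => l; rewrite summxE !mxE; apply: eq_bigr => j _.
by rewrite !mxE -tnth_nth tnth_map mulrC.
Qed.

Section eigenbasis.
Context (W : 'M[C]_d).
Context (hW : forall w, zeros_lt1 A w -> W *m u w = w *: u w).

Lemma eigenbasis_mx (t : d.-tuple C) :
  (forall w, w \in t -> zeros_lt1 A w) ->
  W *m kernel_mx u (tnth t) = kernel_mx u (tnth t) *m diag_mx (\row_j tnth t j).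
Proof.
move=> ht; rewrite mul_mx_diag; apply/matrixP => i j.
have /colP/(_ i) := hW (ht _ (mem_tnth j t)); rewrite !mxE mulrC => H.
by rewrite -[RHS]H; apply: eq_bigr => k _; rewrite !mxE.
Qed.

(** The equation may be tested on the columns of the invertible [kernel_mx], where [W] acts
    diagonally; there it is [kernel_mx_solvent]. *)
Lemma eigenbasis_solvent : solvent W.
Proof.
have [t ut ht] := zeros_lt1_tuple hA hI hII.
have Xu := kernel_basis_unit ut (fun w => proj1 (ht w)).
have WX := eigenbasis_mx (fun w => proj1 (ht w)).
apply: (can_inj (mulmxK Xu)); rewrite mul0mx !mulmxDl -!mulmxA WX.
rewrite [W *m (_ *m _)]mulmxA WX.
rewrite -(kernel_mx_solvent hu (t := tnth t)); last first.
  by move=> j; have /ht[] := mem_tnth j t.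
by rewrite !mulmxDl.
Qed.

Lemma eigenbasis_cvg0 (x : 'cV[C]_d) :
  (fun k => W ^+ k *m x) @ \oo --> (0 : 'cV[C]_d).
Proof.
have [t ut ht] := zeros_lt1_tuple hA hI hII.
have Xu := kernel_basis_unit ut (fun w => proj1 (ht w)).
have WX := eigenbasis_mx (fun w => proj1 (ht w)).
set X := kernel_mx _ _ in Xu WX; set D := diag_mx _ in WX.
have WkX k : W ^+ k *m X = X *m D ^+ k.
  elim: k => [|k IH]; first by rewrite !expr0 mul1mx mulmx1.
  by rewrite !exprS -![_ * _]/(_ *m _) -mulmxA IH mulmxA WX mulmxA.
have D0 : (fun k => D ^+ k *m (invmx X *m x)) @ \oo --> (0 : 'cV[C]_d).
  by apply: diag_mx_expr_cvg0 => j; rewrite mxE; have /ht[] := mem_tnth j t.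
apply/mx_cvg0P => i j; move/mx_cvg0P in D0.
rewrite (_ : (fun k => _) = fun k =>
    \sum_l (D ^+ k *m (invmx X *m x)) l j * X i l).
  by apply: cvg0_sum => l; apply: cvg0Mr.
apply/funext => k /=; rewrite -[x in LHS](mulKVmx Xu) !mulmxA WkX -!mulmxA mxE.
by apply: eq_bigr => l _; rewrite mulrC.
Qed.

Lemma eigenbasis_det : \det W = \big[*%R/1]_(w \in zeros_lt1 A) w.
Proof.
have [t ut ht] := zeros_lt1_tuple hA hI hII.
have Xu := kernel_basis_unit ut (fun w => proj1 (ht w)).
have WX := eigenbasis_mx (fun w => proj1 (ht w)).
have X0 : \det (kernel_mx u (tnth t)) != 0 by rewrite -unitfE -unitmxE.
apply: (mulIf X0); rewrite -det_mulmx WX det_mulmx mulrC; congr (_ * _).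
rewrite det_diag -(_ : [set` t] = zeros_lt1 A); last first.
  by apply/seteqP; split=> w /ht.
by rewrite -fsbig_seq// big_tuple; apply: eq_bigr => j _; rewrite mxE.
Qed.

End eigenbasis.

(** The left factor is [RR + B_R], the matrix inverted in the Schur equation; this is the bridge
    between (i) and the quadratic equation. *)
Lemma solvent_mul W : solvent W <-> (RR + (LL + LR *m W)) *m W = - RL.
Proof.
rewrite /solvent (_ : _ + _ = RL + (RR + (LL + LR *m W)) *m W); last first.
  by rewrite !mulmxDl -(mulmxA LR) -addrCAC -addrA.
by split=> [/eqP|->]; rewrite ?subrr// addrC addr_eq0 => /eqP.
Qed.

(** Each eigenvector of [W] lies in the kernel of [Phi] at its eigenvalue. These kernels are lines,
    so a basis of eigenvectors has [d] distinct eigenvalues, and they exhaust the [d] elements of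
    [zeros_lt1 A]. *)
Lemma solvent_eigenbasis W : diagonalizable W -> solvent W ->
  (forall a (v : 'cV[C]_d), v != 0 -> W *m v = a *: v -> `|a| < 1) ->
  forall w, zeros_lt1 A w -> W *m u w = w *: u w.
Proof.
move=> [P Pu] /similar_diagPex[D /(similarP Pu) PW] WQ Wlt1 w0 hw0.
have [t ut ht] := zeros_lt1_tuple hA hI hII.
(* Diagonalizability reads [P W = D P], so the right eigenvectors are the columns of the inverse of
   [P]. *)
pose Y := invmx P; have Yu : Y \in unitmx by rewrite unitmx_inv.
have WY : W *m Y = Y *m diag_mx D.
  by rewrite -[LHS](mulKmx Pu) [P *m _]mulmxA PW mulmxK.
pose y j := col j Y.
have y0 j : y j != 0.
  apply/eqP => yj; have : Y *m delta_mx j 0 = 0 :> 'cV_d by rewrite -colE.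
  move/(congr1 (mulmx P)); rewrite mulKVmx// mulmx0 => /colP/(_ j)/eqP.
  by rewrite !mxE !eqxx oner_eq0.
have Wy j : W *m y j = D 0 j *: y j.
  rewrite /y colE mulmxA WY mul_mx_diag -!colE.
  by apply/colP => i; rewrite !mxE mulrC.
have Dz j : zeros_lt1 A (D 0 j).
  split; last exact: Wlt1 (y0 j) (Wy j).
  have Qy :
      RL *m y j + D 0 j *: ((LL + RR) *m y j) + D 0 j ^+ 2 *: (LR *m y j) = 0.
    rewrite -[RHS](mul0mx _ (y j)) -[X in _ = X *m _]WQ !mulmxDl -!mulmxA Wy.
    by rewrite -!scalemxAr Wy -!scalemxAr scalerA -expr2 scalerDr.
  have D0 : D 0 j != 0.
    apply/eqP => D0; move: Qy; rewrite D0 expr0n/= !scale0r !addr0 => RLy.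
    have := y0 j; rewrite -(mulKmx (blockRL_unit hA hI) (y j)) RLy mulmx0.
    by rewrite eqxx.
  by apply/zeros_kernel; split=> //; exists (y j) => //; apply/Phi_kernel.
have yu j : exists c, y j = c *: u (D 0 j).
  have [Dzj _] := Dz j; have [_ /(_ (y j)) <-] := hu Dzj.
  have D0 : D 0 j != 0 by have [] := Dzj.
  apply/(Phi_kernel _ _ D0).
  rewrite -[RHS](mul0mx _ (y j)) -[X in _ = X *m _]WQ !mulmxDl -!mulmxA Wy.
  by rewrite -!scalemxAr Wy -!scalemxAr scalerA -expr2 scalerDr.
have Dinj : injective (fun j => D 0 j).
  move=> j k Djk; apply/eqP/negPn/negP => jk.
  have [[c yc] [c' yc']] := (yu j, yu k).
  (* Both columns are multiples of the same [u], so [c' y_j = c y_k]; independence gives [c' = 0],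
     hence [y_k = 0]. *)
  have : Y *m (c' *: delta_mx j 0 - c *: delta_mx k 0) = 0 :> 'cV_d.
    rewrite mulmxBr -!scalemxAr -!colE -/(y j) -/(y k) yc yc' Djk.
    by rewrite !scalerA mulrC subrr.
  move/(congr1 (mulmx P)); rewrite mulKVmx// mulmx0 => /colP/(_ j)/eqP.
  rewrite !mxE !eqxx (negbTE jk) mulr1 mulr0 subr0 => /eqP c'0.
  by have := y0 k; rewrite yc' c'0 scale0r eqxx.
have [_ tD] : (size (codom (fun j => D 0 j)) = size t) *
    (codom (fun j => D 0 j) =i t).
  apply: uniq_min_size; first exact/injectiveP.
    by move=> _ /codomP[j ->]; apply/ht.
  by rewrite size_codom card_ord size_tuple.
have /codomP[j w0E] : w0 \in codom (fun j => D 0 j) by rewrite tD; apply/ht.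
have [c yc] := yu j; rewrite -w0E in yc.
have c0 : c != 0 by apply/eqP => c0; have := y0 j; rewrite yc c0 scale0r eqxx.
apply: (scalerI c0); rewrite scalemxAr -yc Wy -w0E yc !scalerA.
by rewrite mulrC.
Qed.

(** The recurrence at [k = 1], tested on the standard basis, is the quadratic equation; decay along
    an eigenvector puts its eigenvalue in the open disc. *)
Lemma dirichlet_eigenbasis W : diagonalizable W ->
  (forall x : 'cV[C]_d, dirichlet_solution A x (fun k => W ^+ k *m x)) ->
  forall w, zeros_lt1 A w -> W *m u w = w *: u w.
Proof.
move=> dW hx; apply: solvent_eigenbasis => //.
  rewrite /solvent; apply/matrixP => i j.
  have [/(_ 1%N isT) + _ _] := hx (delta_mx j 0 : 'cV[C]_d).
  rewrite /= expr0 expr1 expr2 mul1mx -[W * W]/(W *m W) !mulmxA -!mulmxDl.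
  by rewrite -colE => /colP/(_ i); rewrite !mxE.
move=> a v v0 Wv.
have Wk k : W ^+ k *m v = a ^+ k *: v.
  elim: k => [|k IH]; first by rewrite !expr0 mul1mx scale1r.
  by rewrite exprSr -[_ * _]/(_ *m _) -mulmxA Wv -scalemxAr IH scalerA -exprS.
have [i vi] : exists i, v i 0 != 0.
  apply/existsP; apply: contra_neqT v0 => /existsPn vi.
  by apply/colP => i; apply/eqP; rewrite mxE; move: (vi i); rewrite negbK.
have [_ _ /mx_cvg0P/(_ i 0)/cvgr0Pnorm_lt] := hx v.
(* The radius [|v i 0|] is chosen so that one term [|a^N v_i| < |v_i|] already excludes
   [|a| >= 1]. *)
move=> /(_ `|v i 0|); rewrite normr_gt0 => /(_ vi)[N _ /(_ N (leqnn N))].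
rewrite Wk mxE => aN; apply: contraT; rewrite -real_leNgt ?normr_real// => a1.
suff lt : `|a ^+ N * v i 0| < `|v i 0|.
  have : `|v i 0| <= `|a ^+ N * v i 0|.
    by rewrite normrM normrX ler_peMl// exprn_ege1.
  by move=> /(lt_le_trans lt); rewrite ltxx.
exact: aN.
Qed.

Lemma eigenbasis_dirichlet W :
  (forall w, zeros_lt1 A w -> W *m u w = w *: u w) ->
  forall x : 'cV[C]_d, dirichlet_solution A x (fun k => W ^+ k *m x).
Proof.
move=> hW x; split; [|by rewrite expr0 mul1mx|exact: eigenbasis_cvg0].
move=> [//|k] _ /=.
have := eigenbasis_solvent hW => /(congr1 (mulmx^~ (W ^+ k *m x))).
rewrite /= mul0mx !mulmxDl => H; rewrite -[RHS]H ?mulmxDl.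
by rewrite !exprS -![_ * _]/(_ *m _) -!mulmxA.
Qed.

(** For [X = 1] and [D = W] the boundary term is [B_R] itself, which therefore solves a Stein
    equation. *)
Lemma solvent_gram W : solvent W ->
  (col_mx 1%:M W)^t* *m A *m col_mx 1%:M W
  = (LL + LR *m W) - W^t* *m (LL + LR *m W) *m W.
Proof.
move=> WQ; have := solvent_stein (A := A) (X := 1%:M) (D := W).
rewrite !mulmx1 !mul1mx => /(_ WQ) ->.
by rewrite trmx1 map_mx1 mul1mx.
Qed.

Lemma gram_form (W : 'M[C]_d) (v : 'cV[C]_d) :
  v^t* *m ((col_mx 1%:M W)^t* *m A *m col_mx 1%:M W) *m v
  = (col_mx v (W *m v))^t* *m A *m col_mx v (W *m v).
Proof.
have -> : col_mx v (W *m v) = col_mx 1%:M W *m v by rewrite mul_col_mx mul1mx.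
by rewrite ctmxM !mulmxA.
Qed.

Lemma schur_sum_posdef (B : 'M[C]_d) :
  right_schur_invariant A B -> hermitian_posdef (RR + B).
Proof.
move=> [Bpos _]; split.
  apply/hermsymmxP; rewrite ctmxD (ctmx_blockRR hA).
  by rewrite (proj1 (hermsymmxP _) Bpos.1).
move=> v v0; rewrite mulmxDr mulmxDl mxE; apply: ltr_wpDl; last exact: Bpos.2.
have := posdef_ge0 (col_mx 0 v) hA.
by rewrite quad_block !trmx0 ?map_mx0 mul0mx add0r !mulmx0 add0r mulmxA.
Qed.

(** Cancelling [LL] and the invertible [LR] in the Schur equation gives the quadratic equation. At
    an eigenvector [W v = a v] the Stein identity equates the positive energy with [1 - |a|^2] times
    the positive form of [B_R], so [|a| < 1]. *)
Lemma schur_eigenbasis W : diagonalizable W ->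
  right_schur_invariant A (LL + LR *m W) ->
  forall w, zeros_lt1 A w -> W *m u w = w *: u w.
Proof.
move=> dW BRinv; have [Bpos BE] := BRinv.
have Mu := posdef_unit (schur_sum_posdef BRinv).
have WE : W = - (invmx (RR + (LL + LR *m W)) *m RL).
  apply: (can_inj (mulKmx (blockLR_unit hI))).
  by rewrite mulmxN mulmxA; apply: (addrI LL).
have WQ : solvent W by apply/solvent_mul; rewrite {2}WE mulmxN mulKVmx.
apply: solvent_eigenbasis => // a v v0 Wv.
have := hA.2 (col_mx v (W *m v)); rewrite col_mx_eq0 (negbTE v0) => /(_ isT).
rewrite -gram_form solvent_gram// mulmxBr mulmxBl !mulmxA -ctmxM Wv -!mulmxA Wv.
rewrite -!scalemxAr ctmxZ -!scalemxAl scalerA.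
rewrite [X in 0 < X]mxE [X in _ + X]mxE [X in _ - X]mxE.
rewrite -normCK -{1}[(_ *m _) 0 0]mul1r -mulrBl mulmxA.
rewrite pmulr_lgt0 ?subr_gt0; last exact: Bpos.2.
by rewrite expr_lt1.
Qed.

Lemma eigenbasis_schur W :
  (forall w, zeros_lt1 A w -> W *m u w = w *: u w) ->
  right_schur_invariant A (LL + LR *m W).
Proof.
move=> hW; have WQ := eigenbasis_solvent hW.
have /solvent_mul MW := WQ.
(* Positivity of [B_R] is not yet available; invertibility comes from the product being [- RL]. *)
have /andP[Mu Wu] : (RR + (LL + LR *m W) \in unitmx) && (W \in unitmx).
  rewrite -unitmx_mul MW -scaleN1r unitmxZ ?unitrN ?unitr1//.
  exact: (blockRL_unit hA hI).
split; last first.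
  by rewrite -mulmxA -[RL]opprK -MW mulmxN mulKmx// mulmxN opprK.
have [t ut ht] := zeros_lt1_tuple hA hI hII.
have Xu := kernel_basis_unit ut (fun w => proj1 (ht w)).
have WX := eigenbasis_mx hW (fun w => proj1 (ht w)).
set X := kernel_mx _ _ in Xu WX; set D := diag_mx _ in WX.
set B := LL + LR *m W.
have GE := solvent_gram WQ.
split.
  apply/hermsymmxP/eqP; rewrite -subr_eq0; apply/eqP.
  set K := _ - _.
  (* Since the Gram matrix is Hermitian, the defect [K] solves the homogeneous Stein equation. In
     the basis of the [u_w] each entry of [K] is multiplied by some [conj(w) w'] of modulus below
     [1], so it vanishes. *)
  have KE : K = W^t* *m K *m W.
    have : ((col_mx 1%:M W)^t* *m A *m col_mx 1%:M W)^t*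
        = (col_mx 1%:M W)^t* *m A *m col_mx 1%:M W.
      by rewrite !ctmxM trmxCK (proj1 (hermsymmxP _) hA.1) mulmxA.
    rewrite GE -/B ctmxB !ctmxM trmxCK !mulmxA => /eqP.
    rewrite /K mulmxBr mulmxBl => /eqP H.
    have E : B^t* = W^t* *m B^t* *m W + (B - W^t* *m B *m W).
      by rewrite -H addrC subrK.
    rewrite [X in X - _ = _]E.
    by rewrite -addrA; congr (_ + _); rewrite addrAC subrr add0r.
  have KX : X^t* *m K *m X = D^t* *m (X^t* *m K *m X) *m D.
    by rewrite {1}KE !mulmxA -ctmxM -[in RHS]mulmxA -WX -ctmxM -WX !mulmxA.
  have : X^t* *m K *m X = 0.
    move: (X^t* *m K *m X) KX => L KX; apply/matrixP => i j.
    move/matrixP/(_ i j) : KX.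
    rewrite /D mul_mx_diag tr_diag_mx map_diag_mx mul_diag_mx !mxE => Lij.
    have : (1 - Num.conj (tnth t i) * tnth t j) * L i j = 0.
      by rewrite mulrBl mul1r {1}Lij; ring.
    move/eqP; rewrite mulf_eq0 subr_eq0 => /orP[/eqP h|/eqP//].
    have : `|1 : C| < 1.
      rewrite {1}h normrM norm_conjC mulr_ilt1//.
      - by have /ht[] := mem_tnth i t.
      - by have /ht[] := mem_tnth j t.
    by rewrite normr1 ltxx.
  have Xu' : X^t* \in unitmx by rewrite map_unitmx unitmx_tr.
  move/(congr1 (mulmx (invmx (X^t*)))); rewrite mulmx0 -!mulmxA (mulKmx Xu').
  by move/(congr1 (mulmx^~ (invmx X))); rewrite mul0mx (mulmxK Xu).
move=> v v0.
(* The form of [B_R] at [v] is at least the first term of its energy sum, which is positive. *)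
apply: lt_le_trans (stein_ge GE _ (eigenbasis_cvg0 hW v)).
  by rewrite gram_form; apply: hA.2; rewrite col_mx_eq0 (negbTE v0).
by move=> e; rewrite gram_form; exact: posdef_ge0.
Qed.

End invariant_solvents.

(** * Gaussian integrals over C^n *)

Section measurable_complex.
Context {R : realType} {disp : measure_display} {T : measurableType disp}.
Local Open Scope sesquilinear_scope.
Local Notation C := R[i].

Definition measurable_complex (f : T -> C) :=
  measurable_fun [set: T] (fun x => complex.Re (f x)) /\
  measurable_fun [set: T] (fun x => complex.Im (f x)).

Lemma measurable_complex_cst (c : C) : measurable_complex (fun=> c).
Proof. by split; exact: measurable_cst. Qed.

Lemma measurable_complexD (f g : T -> C) : measurable_complex f ->
  measurable_complex g -> measurable_complex (fun x => f x + g x).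
Proof.
move=> [f1 f2] [g1 g2]; split; under eq_fun do rewrite raddfD/=;
  exact: measurable_funD.
Qed.

Lemma measurable_complexM (f g : T -> C) : measurable_complex f ->
  measurable_complex g -> measurable_complex (fun x => f x * g x).
Proof.
move=> [f1 f2] [g1 g2]; split.
- rewrite (_ : (fun x => _) = fun x =>
      complex.Re (f x) * complex.Re (g x)
      - complex.Im (f x) * complex.Im (g x)).
    by apply: measurable_funB; exact: measurable_funM.
  by apply/funext => x; case: (f x) (g x) => ? ? [].
- rewrite (_ : (fun x => _) = fun x =>
      complex.Re (f x) * complex.Im (g x)
      + complex.Im (f x) * complex.Re (g x)).
    by apply: measurable_funD; exact: measurable_funM.
  by apply/funext => x; case: (f x) (g x) => ? ? [].
Qed.

Lemma measurable_complex_conj (f : T -> C) : measurable_complex f ->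
  measurable_complex (fun x => Num.conj (f x)).
Proof.
move=> [f1 f2]; split.
- rewrite (_ : (fun x => _) = fun x => complex.Re (f x))//.
  by apply/funext => x; case: (f x).
- rewrite (_ : (fun x => _) = fun x => - complex.Im (f x)).
    exact: measurable_funN.
  by apply/funext => x; case: (f x).
Qed.

Lemma measurable_complex_sum n (f : 'I_n -> T -> C) :
  (forall i, measurable_complex (f i)) ->
  measurable_complex (fun x => \sum_i f i x).
Proof.
move=> mf; elim: (index_enum _) => [|i r IHr].
  under eq_fun do rewrite big_nil; exact: measurable_complex_cst.
under eq_fun do rewrite big_cons; exact: measurable_complexD.
Qed.

Lemma measurable_quad n (M : 'M[C]_n) (v : T -> 'cV[C]_n) :
  (forall i, measurable_complex (fun x => v x i 0)) ->
  measurable_complex (fun x => ((v x)^t* *m M *m v x) 0 0).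
Proof.
move=> mv; rewrite (_ : (fun x => _) =
    fun x => \sum_j (\sum_i Num.conj (v x i 0) * M i j) * v x j 0).
  apply: measurable_complex_sum => j; apply: measurable_complexM => //.
  apply: measurable_complex_sum => i; apply: measurable_complexM.
    exact: measurable_complex_conj.
  exact: measurable_complex_cst.
apply/funext => x; rewrite mxE; apply: eq_bigr => j _; rewrite mxE.
by congr (_ * _); apply: eq_bigr => i _; rewrite !mxE.
Qed.

End measurable_complex.

Section gaussian_integral.
Context {R : realType}.
Local Open Scope sesquilinear_scope.
Local Notation C := R[i].
Local Notation mu := (@lebesgue_measure R).

Lemma integral_gauss1 (m a : R) : 0 < m ->
  (\int[mu]_x (expR (- 2^-1 * (m * (x + a) ^+ 2)))%:E
   = (Num.sqrt (2 * pi / m))%:E)%E.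
Proof.
(* The integrand is a multiple of the normal density of mean [-a] and standard deviation [s]. *)
move=> m0; pose s := (Num.sqrt m)^-1.
have s2 : s ^+ 2 = m^-1 by rewrite exprVn sqr_sqrtr// ltW.
have s0 : s != 0 by rewrite invr_eq0 sqrtr_eq0 -ltNge.
have peakV : (normal_peak s)^-1 = Num.sqrt (2 * pi / m).
  by rewrite /normal_peak invrK s2; congr Num.sqrt; field; rewrite gt_eqF.
transitivity ((normal_peak s)^-1%:E
    * \int[mu]_x (normal_pdf (- a) s x)%:E)%E; last first.
  by rewrite integral_normal_pdf mule1 peakV.
rewrite -ge0_integralZl_EFin//=.
- apply: eq_integral => x _; rewrite -EFinM normal_pdfE//.
  rewrite mulKf ?gt_eqF ?normal_peak_gt0//.
  by rewrite /normal_fun s2 opprK; congr (expR _)%:E; field; rewrite gt_eqF.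
- by move=> x _; rewrite lee_fin normal_pdf_ge0.
- by apply/measurable_EFinP; exact: measurable_normal_pdf.
- by rewrite invr_ge0 normal_peak_ge0.
Qed.

Lemma integral_gauss2 (m : R) (k : C) : 0 < m ->
  (\int[@lebesgue2 R]_p (expR (- 2^-1 *
     (m * ((p.1 + complex.Re k) ^+ 2 + (p.2 + complex.Im k) ^+ 2))))%:E
   = (2 * pi / m)%:E)%E.
Proof.
move=> m0.
rewrite -[LHS]/(\int[mu \x mu]_p _)%E fubini_tonelli1//=; last first.
  apply/measurable_EFinP; apply: measurableT_comp => //.
  apply: measurable_funM => //; apply: measurable_funM => //.
  by apply: measurable_funD; apply: measurable_funX; apply: measurable_funD.
pose g a x := expR (- 2^-1 * (m * (x + a) ^+ 2)).
transitivity (\int[mu]_x ((g (complex.Re k) x)%:E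
    * (Num.sqrt (2 * pi / m))%:E))%E.
  apply: eq_integral => x _; rewrite /fubini_F/=.
  rewrite -(integral_gauss1 (complex.Im k) m0).
  rewrite -ge0_integralZl//=; last 2 first.
  - apply/measurable_EFinP; apply: measurableT_comp => //.
    apply: measurable_funM => //; apply: measurable_funM => //.
    by apply: measurable_funX; apply: measurable_funD.
  - by rewrite lee_fin expR_ge0.
  apply: eq_integral => y _; rewrite -EFinM -expRD; congr (expR _)%:E; ring.
rewrite ge0_integralZr//=; last 2 first.
- apply/measurable_EFinP; apply: measurableT_comp => //.
  apply: measurable_funM => //; apply: measurable_funM => //.
  by apply: measurable_funX; apply: measurable_funD.
- by move=> x _; rewrite lee_fin expR_ge0.
rewrite integral_gauss1// -EFinM -expr2 sqr_sqrtr//.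
by rewrite divr_ge0 ?mulr_ge0 ?pi_ge0 ?ltW.
Qed.


Definition schur n (M : 'M[C]_(1 + n)) : 'M[C]_n :=
  drsubmx M - dlsubmx M *m ((M 0 0)^-1 *: ursubmx M).

Section schur_complement.
Context {n : nat} (M : 'M[C]_(1 + n)).
Context (Mpos : hermitian_posdef M).
Let a := M 0 0.
Let r := ursubmx M.

Let a_gt0 : 0 < a.
Proof.
have := Mpos.2 (delta_mx 0 0); rewrite -mulmxA -colE => /(_ _).
rewrite (_ : (_ *m _) 0 0 = a).
  apply; apply/eqP => /matrixP/(_ 0 0)/eqP.
  by rewrite !mxE !eqxx oner_eq0.
rewrite mxE (bigD1 0)//= big1 ?addr0 => [|i i0].
  by rewrite !mxE !eqxx rmorph1 mul1r.
by rewrite !mxE (negbTE i0) rmorph0 mul0r.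
Qed.

Let ulE : ulsubmx M = a%:M.
Proof.
apply/matrixP => i j; rewrite !ord1 !mxE eqxx mulr1n.
by congr (M _ _); apply: val_inj.
Qed.

Let dlE : dlsubmx M = r^t*.
Proof. by rewrite trmx_ursub map_dlsubmx (proj1 (hermsymmxP _) Mpos.1). Qed.

(** Completing the square in the first coordinate: [z] is only shifted, by an amount depending on
    [w], and the rest is a form in [w] alone. *)
Lemma schur_form (z : 'cV[C]_1) (w : 'cV[C]_n) :
  (col_mx z w)^t* *m M *m col_mx z w
  = a *: ((z + a^-1 *: (r *m w))^t* *m (z + a^-1 *: (r *m w)))
    + w^t* *m schur M *m w.
Proof.
have a0 : a != 0 by rewrite gt_eqF.
have aR : Num.conj a^-1 = a^-1 by apply: CrealP; rewrite gtr0_real ?invr_gt0.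
rewrite tr_col_mx map_row_mx -mulmxA -{1}[M]submxK mul_block_col mul_row_col.
rewrite /schur -/a -/r dlE ulE mul_scalar_mx.
rewrite ctmxD ctmxZ aR ctmxM !(mulmxDr, mulmxDl, mulmxN, mulNmx).
rewrite -!(scalemxAr, scalemxAl) !scalerDr !scalerA !mulmxA ?mulrA mulfV//.
rewrite ?mul1r !scale1r -!addrA; congr (_ + _).
by rewrite [X in _ = _ + (_ + X)]addrC subrK addrCA.
Qed.

(** Block triangular factorisation with pivot [a]. *)
Lemma schur_det : \det M = a * \det (schur M).
Proof.
have a0 : a != 0 by rewrite gt_eqF.
have ME : M = block_mx a%:M 0 (r^t*) (schur M)
              *m block_mx 1%:M (a^-1 *: r) 0 1%:M.
  rewrite mulmx_block !mulmx1 !mulmx0 !addr0 mul_scalar_mx scalerA mulfV//.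
  rewrite scale1r /schur -/a -/r dlE [_ *m _ + _]addrC subrK.
  by rewrite -[LHS]submxK dlE ulE.
rewrite [M in LHS]ME det_mulmx det_lblock det_ublock.
by rewrite !det1 !mulr1 det_scalar1.
Qed.

Lemma schur_posdef : hermitian_posdef (schur M).
Proof.
have aR : Num.conj a^-1 = a^-1 by apply: CrealP; rewrite gtr0_real ?invr_gt0.
split.
  apply/hermsymmxP; rewrite /schur -/a -/r dlE ctmxB ctmxM ctmxZ trmxCK aR.
  rewrite -scalemxAl -scalemxAr; congr (_ - _).
  by rewrite trmx_drsub map_drsubmx (proj1 (hermsymmxP _) Mpos.1).
(* This first coordinate makes the completed square vanish. *)
move=> w w0; have := Mpos.2 (col_mx (- (a^-1 *: (r *m w))) w).
rewrite col_mx_eq0 (negbTE w0) andbF => /(_ isT).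
by rewrite schur_form addNr trmx0 map_mx0 mul0mx scaler0 add0r.
Qed.

Lemma schur_corner_gt0 : 0 < M 0 0. Proof. exact: a_gt0. Qed.

End schur_complement.

Lemma cvec_cons n p (t : n.-tuple (measurableTypeR R * measurableTypeR R)) :
  cvec (tuple_cons (p, t)) = col_mx (p.1 +i* p.2)%:M (cvec t) :> 'cV[C]_(1 + n).
Proof.
apply/colP => i; rewrite !mxE; case: splitP => j ij.
  rewrite ord1 !mxE eqxx mulr1n (_ : i = ord0)//.
  by apply: ord_inj; rewrite ij ord1.
rewrite mxE (_ : i = lift ord0 j) ?tnthS; last by apply: ord_inj; rewrite ij.
by congr (_ +i* _); congr (_ (tnth _ _)); apply: val_inj.
Qed.

Lemma cvec_consD n p (t : n.-tuple (measurableTypeR R * measurableTypeR R))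
    (h : 'cV[C]_(1 + n)) :
  (cvec (tuple_cons (p, t)) : 'cV[C]_(1 + n)) + h
  = col_mx ((p.1 +i* p.2)%:M + usubmx h) (cvec t + dsubmx h) :> 'cV[C]_(1 + n).
Proof. by rewrite cvec_cons -{1}[h]vsubmxK add_col_mx. Qed.

Lemma measurable_gauss n (M : 'M[C]_n) (h : 'cV[C]_n) :
  measurable_fun [set: n.-tuple (measurableTypeR R * measurableTypeR R)]
    (fun t => expR (- 2^-1 *
       complex.Re (((cvec t + h)^t* *m M *m (cvec t + h)) 0 0))).
Proof.
apply: measurableT_comp => //; apply: measurable_funM => //.
apply: (measurable_quad _ _).1 => i.
under eq_fun do rewrite !mxE.
apply: measurable_complexD; last exact: measurable_complex_cst.
by split; apply: measurableT_comp => //; exact: measurable_tnth.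
Qed.

Lemma form_cV1 (v : 'cV[C]_1) : (v^t* *m v) 0 0 = Num.conj (v 0 0) * v 0 0.
Proof. by rewrite mxE big_ord1 !mxE. Qed.

(** Induction on [n]: integrating out the first coordinate yields [2 pi / b], whatever the others,
    and leaves the Gaussian of the Schur complement. The real [D] stands for the complex-valued
    determinant inside a real integral. *)
Lemma integral_gauss n (M : 'M[C]_n) : hermitian_posdef M ->
  exists D : R, [/\ 0 < D, \det M = D%:C & forall h : 'cV[C]_n,
    (\int[lebesgue_complex R n]_t (expR (- 2^-1 *
       complex.Re (((cvec t + h)^t* *m M *m (cvec t + h)) 0 0)))%:E
     = ((2 * pi) ^+ n / D)%:E)%E].
Proof.
elim: n M => [|n IHn] M Mpos.
  exists 1; split=> // [|h]; first by rewrite det_mx00.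
  under eq_integral do rewrite mxE big_ord0 mulr0 expR0.
  by rewrite /= integral_cst//= diracT mule1 expr0 divr1.
have [D [D0 detS IH]] := IHn _ (schur_posdef Mpos).
have := schur_corner_gt0 Mpos.
set a := M 0 0 => a_gt0.
have [b ab] : exists b : R, a = b%:C.
  by exists (complex.Re a); rewrite RRe_real// gtr0_real.
have b0 : 0 < b by move: a_gt0; rewrite ab ltcR.
exists (b * D); split; first exact: mulr_gt0.
  by rewrite (schur_det Mpos) -/a ab detS rmorphM.
move=> h.
have mG := measurable_gauss M h.
set G := fun t => expR _ in mG *.
rewrite -[LHS]/(\int[pushforward (@lebesgue2 R \x lebesgue_complex R n)
                       (@tuple_cons _ _ n)]_t (G t)%:E)%E.
rewrite ge0_integral_pushforward//=; last first.
- by move=> y _; rewrite lee_fin expR_ge0.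
- exact/measurable_EFinP.
- exact: measurable_tuple_cons.
rewrite preimage_setT fubini_tonelli2//=; last 2 first.
- apply/measurable_EFinP; apply: measurableT_comp mG _.
  exact: measurable_tuple_cons.
- by move=> x; rewrite lee_fin expR_ge0.
pose h0 : 'cV[C]_1 := usubmx (h : 'cV[C]_(1 + n)).
pose h1 : 'cV[C]_n := dsubmx (h : 'cV[C]_(1 + n)).
pose q t := complex.Re
  (((cvec t + h1)^t* *m schur (M : 'M[C]_(1 + n)) *m (cvec t + h1)) 0 0).
transitivity (\int[lebesgue_complex R n]_t
    ((2 * pi / b)%:E * (expR (- 2^-1 * q t))%:E))%E.
  apply: eq_integral => t _; rewrite /fubini_G.
  (* For a fixed tail [t], this is the total translation of the first coordinate; the inner integral
     does not depend on it. *)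
  pose k := (h0 + a^-1 *: (ursubmx (M : 'M[C]_(1 + n)) *m (cvec t + h1))) 0 0.
  rewrite -(integral_gauss2 k b0) -ge0_integralZr//=; last first.
    apply/measurable_EFinP; apply: measurableT_comp => //.
    apply: measurable_funM => //; apply: measurable_funM => //.
    by apply: measurable_funD; apply: measurable_funX; apply: measurable_funD.
  apply: eq_integral => p _; rewrite -EFinM -expRD -mulrDr.
  congr (expR (_ * _))%:E.
  rewrite /G.
  have := cvec_consD p t h; rewrite -/h0 -/h1 => ->.
  rewrite (schur_form Mpos) -/a mxE raddfD/=; congr (_ + _).
  rewrite [X in complex.Re X]mxE form_cV1 -addrA.
  rewrite [X in _ * (_ * X)]mxE [X in _ * (_ X * _)]mxE -/k !mxE eqxx mulr1n ab.
  by case: k => k1 k2; simpc => /=; ring.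
rewrite ge0_integralZl//=; last 2 first.
- by apply/measurable_EFinP; exact: (measurable_gauss (schur M) h1).
- rewrite lee_fin; apply/ltW/divr_gt0 => //; apply: mulr_gt0 => //.
  exact: pi_gt0.
rewrite IH -EFinM; congr _%:E; rewrite exprS.
by field; rewrite !gt_eqF.
Qed.

End gaussian_integral.

(** * The Gaussian eigenfunction *)

Section gaussian_eigenfunction.
Local Open Scope sesquilinear_scope.
Context {R : realType} {d : nat} (A : 'M[R[i]]_(d + d)) (B : 'M[R[i]]_d).
Context (hA : hermitian_posdef A) (hB : right_schur_invariant A B).
Local Notation C := R[i].
Local Notation LL := (blockLL A).
Local Notation LR := (blockLR A).
Local Notation RL := (blockRL A).
Local Notation RR := (blockRR A).
Local Notation M := (RR + B).

(** The shift [h] absorbs the cross terms because [M h = RL x]; what is left in [x] is the form of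
    [LL - LR M^-1 RL], which is [B] by Schur invariance. *)
Lemma schur_complete_square (x y : 'cV[C]_d) (h := invmx M *m (RL *m x)) :
  (col_mx x y)^t* *m A *m col_mx x y + y^t* *m B *m y
  = (y + h)^t* *m M *m (y + h) + x^t* *m B *m x.
Proof.
have Mu := posdef_unit (schur_sum_posdef hA hB).
have Mh : M *m h = RL *m x by rewrite mulKVmx.
have hM : h^t* *m M = x^t* *m LR.
  rewrite -[M in LHS](proj1 (hermsymmxP _) (schur_sum_posdef hA hB).1).
  by rewrite -ctmxM Mh ctmxM (ctmx_blockRL hA).
have BE : x^t* *m B *m x = x^t* *m LL *m x - x^t* *m LR *m h.
  by rewrite {1}hB.2 mulmxBr mulmxBl /h !mulmxA.
rewrite quad_block BE ctmxD [(_ + _) *m M]mulmxDl hM mulmxDl.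
rewrite -[_ *m M *m _]mulmxA.
rewrite [M *m _]mulmxDr Mh [M *m y]mulmxDl !mulmxDr !mulmxA.
move: (x^t* *m LL *m x) (x^t* *m LR *m y) (y^t* *m RL *m x) (y^t* *m RR *m y)
  (y^t* *m B *m y) (x^t* *m LR *m invmx M *m RL *m x) => a b c e f g.
by apply/matrixP => i j; rewrite !mxE; ring.
Qed.

Lemma gauss_eigenfunction (alpha beta : R) (x : 'cV[C]_d) :
  0 < alpha -> 0 < beta ->
  let f := fun t => gauss2 alpha A x (cvec t) * gauss1 beta B (cvec t) in
  (lebesgue_complex R d).-integrable setT (EFin \o f) /\
  (\int[lebesgue_complex R d]_t f t)%:C
  = (alpha * (2 * pi) ^+ d)%:C / \det M * (gauss1 beta B x)%:C.
Proof.
move=> alpha0 beta0 f.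
have [D [D0 detM IM]] := integral_gauss (schur_sum_posdef hA hB).
pose h := invmx M *m (RL *m x).
pose g t := expR (- 2^-1 *
  complex.Re (((cvec t + h)^t* *m M *m (cvec t + h)) 0 0)).
have ReD (a b : C) : complex.Re (a + b) = complex.Re a + complex.Re b.
  by case: a b => ? ? [].
have fE : f = fun t => alpha * gauss1 beta B x * g t.
  apply/funext => t; rewrite /f /gauss2 /gauss1 /g.
  have E := congr1 (fun N : 'M[C]_1 => complex.Re (N 0 0))
    (schur_complete_square x (cvec t)).
  rewrite /= [X in complex.Re X = _]mxE [X in _ = complex.Re X]mxE in E.
  rewrite !ReD -/h in E.
  rewrite [LHS]mulrACA -expRD -mulrDr E mulrDr expRD.
  by rewrite -/(g t); ring.
have K0 : 0 <= alpha * gauss1 beta B x.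
  by rewrite /gauss1 !mulr_ge0 ?expR_ge0 ?ltW.
have g0 t : 0 <= g t by exact: expR_ge0.
have mg : measurable_fun setT g by exact: measurable_gauss.
have If : (\int[lebesgue_complex R d]_t (f t)%:E
    = (alpha * gauss1 beta B x * ((2 * pi) ^+ d / D))%:E)%E.
  under eq_integral do rewrite fE EFinM.
  rewrite ge0_integralZl_EFin//; first by rewrite (IM h) -EFinM.
  - by move=> t _; rewrite lee_fin.
  - exact/measurable_EFinP.
split.
  apply/integrableP; split.
    by apply/measurable_EFinP; rewrite fE; apply: measurable_funM.
  rewrite (eq_integral (fun t => (f t)%:E)) ?If ?ltry// => t _.
  by rewrite /= ger0_norm// fE mulr_ge0.
rewrite /Rintegral If/= detM.
rewrite !rmorphM/= fmorphV/=.
by ring.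
Qed.

End gaussian_eigenfunction.

Theorem theorem5p1 (R : realType) (d : nat) (hd : (0 < d)%N)
    (A : 'M[R[i]]_(d + d)) (hA : hermitian_posdef A)
    (hI : assumptionI A) (hII : assumptionII A)
    (u : R[i] -> 'cV[R[i]]_d) (hu : spans_kernels A u)
    (W : 'M[R[i]]_d) (hW : diagonalizable W) :
  let BR := blockLL A + blockLR A *m W in
  let assertion_i := right_schur_invariant A BR in
  let assertion_ii :=
    forall w, zeros_lt1 A w -> W *m u w = w *: u w in
  let assertion_iii :=
    forall x : 'cV[R[i]]_d, dirichlet_solution A x (fun k => W ^+ k *m x) in
  [/\ is_basis_on (zeros_lt1 A) u,
      assertion_i <-> assertion_ii,
      assertion_ii <-> assertion_iii
    & assertion_i ->
      forall alpha beta : R, 0 < alpha -> 0 < beta ->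
      let Lambda : R[i] :=
        (alpha * (2 * pi) ^+ d)%:C * (-1) ^+ d
        * (\big[*%R/1]_(w \in zeros_lt1 A) w) / \det (blockRL A) in
      forall x : 'cV[R[i]]_d,
        let f := fun t => gauss2 alpha A x (cvec t) * gauss1 beta BR (cvec t) in
        (lebesgue_complex R d).-integrable setT (EFin \o f) /\
        (\int[lebesgue_complex R d]_t f t)%:C
          = Lambda * (gauss1 beta BR x)%:C].
Proof.
move=> BR assertion_i assertion_ii assertion_iii; split.
- exact: kernel_basis.
- by split; [exact: schur_eigenbasis | exact: (eigenbasis_schur hA hI hII hu)].
- split; first exact: (eigenbasis_dirichlet hA hI hII hu).
  exact: dirichlet_eigenbasis.
- move=> BRinv alpha beta alpha0 beta0 Lambda x f.
  have [intf intE] := gauss_eigenfunction hA BRinv x alpha0 beta0.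
  split=> //; rewrite intE; congr (_ * _); rewrite /Lambda.
  have hWu := schur_eigenbasis hA hI hII hu hW BRinv.
  rewrite -(eigenbasis_det hA hI hII hu hWu).
  have RL0 : \det (blockRL A) != 0 by rewrite -unitfE -unitmxE blockRL_unit.
  have M0 : \det (blockRR A + BR) != 0.
    by rewrite -unitfE -unitmxE posdef_unit//; exact: (schur_sum_posdef hA).
  have /solvent_mul := eigenbasis_solvent hA hI hII hu hWu.
  move=> /(congr1 determinant); rewrite det_mulmx -scaleN1r detZ => E.
  have -> : \det W = (-1) ^+ d * \det (blockRL A) / \det (blockRR A + BR).
    by rewrite -E [X in X / _]mulrC mulfK.
  (* The sign in [Lambda] cancels the one from [det (- RL)], which leaves the factor [1 / det M] of
     the Gaussian integral. *)
  have sign2 : (-1) ^+ d * (-1) ^+ d = 1 :> R[i] by rewrite -expr2 sqrr_sign.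
  move: sign2 RL0 M0 => {E}; move: (\det _) (\det _) ((-1) ^+ d) _%:C.
  move=> m r s c ss r0 m0; rewrite -[LHS]mul1r -[X in X * _ = _]ss.
  by field; rewrite r0.
Qed.
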